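(* Let $g,n\in\mathbb{N}$ with $g>3$ and $2\le n\le g-2$. The oriented graph $\mathcal{T}_{g,n}$ is a rooted tree whose root is $S_{g,n}$. Moreover, for $T\in\mathcal{H}_{g,n}$, the children of $T$ in $\mathcal{T}_{g,n}$ (the $S$ with $(S,T)$ an edge) are exactly the semigroups $(T\cup\{h\})\setminus\{y\}$ where $h\in\operatorname{SG}(T)$ with $h<\operatorname{m}(T)$, and $y$ is a minimal generator of $T\cup\{h\}$ with $y\neq h$ such that: if $T\cup\{h\}$ is irreducible then $\frac{\operatorname{F}(T)}{2}<y<\operatorname{F}(T)$; and if $T\cup\{h\}$ is not irreducible then $\max\big(\operatorname{SG}(T\cup\{h\})\setminus\{\operatorname{F}(T)\}\big)<y<\operatorname{F}(T)$.
   Context: $\mathbb{N}=\{0,1,2,\ldots\}$. A numerical semigroup is a submonoid $S$ of $(\mathbb{N},+)$ with $\mathbb{N}\setminus S$ finite; a minimal generator is an element of $S\setminus\{0\}$ not expressible as a sum of two elements of $S\setminus\{0\}$. $\operatorname{H}(S)=\mathbb{N}\setminus S$; $\operatorname{g}(S)=|\operatorname{H}(S)|$; $\operatorname{F}(S)=\max\operatorname{H}(S)$; $\operatorname{m}(S)=\min(S\setminus\{0\})$; $\operatorname{n}(S)=|\{s\in S\mid s<\operatorname{F}(S)\}|$. Special gaps: $\operatorname{SG}(S)=\{h\in\operatorname{H}(S)\mid 2h\in S \text{ and } h+s\in S \text{ for all } s\in S\setminus\{0\}\}$. $S$ is special if there is no $h\in\operatorname{SG}(S)\setminus\{\operatorname{F}(S)\}$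 with $h>\operatorname{m}(S)$. $S$ is irreducible if it cannot be written as the intersection of two numerical semigroups properly containing $S$. For non special $S$, $\mathcal{A}(S)=(S\cup\{h\})\setminus\{\operatorname{m}(S)\}$ with $h=\max(\operatorname{SG}(S)\setminus\{\operatorname{F}(S)\})$. $S_{g,n}=\{0\}\cup\{g,\ldots,g+n-2\}\cup\{x\in\mathbb{N}\mid x\ge g+n\}$ (the almost-ordinary semigroup of genus $g$ with $\operatorname{n}(S_{g,n})=n$). $\mathcal{H}_{g,n}$ is the set consisting of $S_{g,n}$ and all non special numerical semigroups $S$ with $\operatorname{g}(S)=g$, $\operatorname{n}(S)=n$. $\mathcal{T}_{g,n}$ is the oriented graph with vertex set $\mathcal{H}_{g,n}$ and edge set all pairs $(S,\mathcal{A}(S))$ with $S\in\mathcal{H}_{g,n}$ non special. An oriented graph is a rooted tree with root $r$ if for every other vertex $x$ there is a unique path (sequence of distinct edges $(v_0,v_1),\ldots,(v_{k-1},v_k)$ with $v_0=x$, $v_k=r$) from $x$ to $r$. *)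

(* Defs.v *)
From mathcomp Require Import all_boot finmap.
From mathcomp Require Import boolp classical_sets cardinality.

Set Implicit Arguments.
Unset Strict Implicit.
Unset Printing Implicit Defensive.

Local Open Scope classical_set_scope.
Local Open Scope nat_scope.

(* [max_nat A] is 0 when [A] is empty or unbounded, and [min_nat A] is 0 when
   [A] is empty. *)
Definition max_nat (A : set nat) : nat :=
  xget 0 [set x | A x /\ forall y, A y -> y <= x].

Definition min_nat (A : set nat) : nat :=
  xget 0 [set x | A x /\ forall y, A y -> x <= y].

(* Meaningful for finite [A] only: [fset_set] is empty on an infinite set. *)
Definition card_nat (A : set nat) : nat := #|` fset_set A|%fset.

Definition numerical_semigroup (S : set nat) : Prop :=
  [/\ S 0, forall a b, S a -> S b -> S (a + b) & finite_set (~` S)].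

Definition minimal_generator (S : set nat) (x : nat) : Prop :=
  (S `\ 0) x /\ ~ exists a b, [/\ (S `\ 0) a, (S `\ 0) b & x = a + b].

Definition gaps (S : set nat) : set nat := ~` S.

Definition genus (S : set nat) : nat := card_nat (gaps S).

(* Among numerical semigroups, only [setT] gets the junk value. *)
Definition Frobenius (S : set nat) : nat := max_nat (gaps S).

Definition multiplicity (S : set nat) : nat := min_nat (S `\ 0).

Definition num_small (S : set nat) : nat :=
  card_nat [set s | S s /\ s < Frobenius S].

Definition special_gaps (S : set nat) : set nat :=
  [set h | [/\ gaps S h, S (2 * h) & forall s, (S `\ 0) s -> S (h + s)]].

Definition special (S : set nat) : Prop :=
  ~ exists h, (special_gaps S `\ Frobenius S) h /\ multiplicity S < h.

Definition irreducible (S : set nat) : Prop :=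
  ~ exists S1 S2, [/\ numerical_semigroup S1, numerical_semigroup S2,
                      S `<` S1, S `<` S2 & S = S1 `&` S2].

(* Meaningful when [S] is not special, so that the maximum exists. *)
Definition calA (S : set nat) : set nat :=
  (S `|` [set max_nat (special_gaps S `\ Frobenius S)]) `\ multiplicity S.

Definition almost_ordinary (g n : nat) : set nat :=
  [set x | [\/ x = 0, g <= x <= g + n - 2 | g + n <= x]].

Definition vertices (g n : nat) : set (set nat) :=
  [set S | S = almost_ordinary g n \/
           [/\ numerical_semigroup S, ~ special S, genus S = g & num_small S = n]].

Definition edges (g n : nat) : set (set nat * set nat) :=
  [set e | [/\ vertices g n e.1, ~ special e.1 & e.2 = calA e.1]].

Fixpoint chain (V : eqType) (E : set (V * V)) (x y : V) (p : seq (V * V)) : Prop :=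
  match p with
  | [::] => x = y
  | e :: p' => [/\ E e, e.1 = x & chain E e.2 y p']
  end.

Definition is_path (V : eqType) (E : set (V * V)) (x y : V) (p : seq (V * V)) : Prop :=
  uniq p /\ chain E x y p.

(* [VS] and [E] are the vertex and edge sets; the first clause says that
   [(VS, E)] is a graph at all, i.e. that edges join vertices. *)
Definition rooted_tree (V : eqType) (VS : set V) (E : set (V * V)) (r : V) : Prop :=
  [/\ E `<=` VS `*` VS, VS r &
      forall x, VS x -> x <> r -> exists! p, is_path E x r p].

Definition children (g n : nat) (T : set nat) : set (set nat) :=
  [set S | edges g n (S, T)].

(* Main.v *)
(* Throughout, F is the Frobenius number and m the multiplicity.  Passing from S
   to A(S) trades m(S) < F for a gap h < F, so it preserves F, the genus and the
   number of small elements, and increases m; hence iterating A stops, at a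
   special semigroup T.  In T both m(S) and F - m(S) are gaps, and the largest
   gap z with F - z a gap is always special; as T is special, z < m(T), which
   leaves no gap but F above m(T): T is almost ordinary.  Existence and
   uniqueness of paths follow, since A is a function.

   For the children, undoing A means adding h = m(S) and removing
   y = max (SG(S) \ {F}).  Both the irreducible and the non irreducible condition
   amount to F < 2y together with y > z for all special gaps z <> F of
   U = T + {h}; in the non irreducible case F < 2y holds because U then has a
   special gap z <> F with F < 2z. *)
Require Import Defs.
From mathcomp Require Import all_boot finmap zify.
From mathcomp Require Import boolp classical_sets cardinality.

Local Open Scope classical_set_scope.
Local Open Scope nat_scope.

(** * Extrema and cardinalities of sets of naturals *)

Lemma max_natE (A : set nat) x :
  A x -> (forall y, A y -> y <= x) -> max_nat A = x.
Proof.
move=> Ax xub; apply: xget_unique => [|z [Az zub]]; first by [].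
by apply/eqP; rewrite eqn_leq xub //= zub.
Qed.

Lemma max_natP (A : set nat) b :
  A !=set0 -> (forall y, A y -> y <= b) ->
  A (max_nat A) /\ forall y, A y -> y <= max_nat A.
Proof.
move=> [a Aa] Ab.
have exA : exists i, `[< A i >] by exists a; apply/asboolP.
have ubA i : `[< A i >] -> i <= b by move/asboolP/Ab.
case: (ex_maxnP exA ubA) => x /asboolP Ax xub.
rewrite (max_natE A x) //; first by split=> // y Ay; apply/xub/asboolP.
by move=> y Ay; apply/xub/asboolP.
Qed.

Lemma min_natE (A : set nat) x :
  A x -> (forall y, A y -> x <= y) -> min_nat A = x.
Proof.
move=> Ax xlb; apply: xget_unique => [|z [Az zlb]]; first by [].
by apply/eqP; rewrite eqn_leq xlb // zlb.
Qed.

Lemma min_natP (A : set nat) :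
  A !=set0 -> A (min_nat A) /\ forall y, A y -> min_nat A <= y.
Proof.
move=> [a Aa].
have exA : exists i, `[< A i >] by exists a; apply/asboolP.
case: (ex_minnP exA) => x /asboolP Ax xlb.
rewrite (min_natE A x) //; first by split=> // y Ay; apply/xlb/asboolP.
by move=> y Ay; apply/xlb/asboolP.
Qed.

Lemma card_natE (A : set nat) (s : seq nat) :
  uniq s -> (forall x, A x <-> x \in s) -> card_nat A = size s.
Proof.
move=> us As.
have fA : finite_set A.
  by apply/finite_seqP; exists s; apply/seteqP; split=> x /=; rewrite -As.
apply: perm_size; apply: uniq_perm => [|//|x]; first exact: fset_uniq.
by rewrite in_fset_set //; apply/idP/idP => [/set_mem/As|/As/mem_set].
Qed.

Lemma card_nat_swap (A : set nat) a b : finite_set A -> A a -> ~ A b ->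
  card_nat ((A `\ a) `|` [set b]) = card_nat A.
Proof.
move=> /finite_seqP[t ->{A}] at_ bt.
have Et x : [set` t] x <-> x \in undup t by rewrite mem_undup.
have [at' bt'] : a \in undup t /\ b \notin undup t.
  by split; [apply/Et|apply/negP => /Et].
have ut := undup_uniq t.
have u' : uniq (b :: rem a (undup t)).
  by rewrite /= rem_uniq // andbT; apply: contra bt' => /mem_rem.
rewrite (card_natE _ _ ut Et) (card_natE _ _ u') /=.
  by rewrite size_rem //; case: (undup t) at'.
move=> x; rewrite inE mem_rem_uniq // inE /=; split.
  by move=> [[/Et -> /eqP ->]|->]; rewrite ?orbT ?eqxx.
by case/orP => [/eqP|/andP[/eqP ? /Et ?]]; [right|left].
Qed.

(** * Gaps, special gaps and irreducibility of a numerical semigroup *)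

Section Semigroup.
Variables (S : set nat).
Hypothesis SN : numerical_semigroup S.
Local Notation F := (Frobenius S).
Local Notation m := (multiplicity S).

Lemma gaps_bounded : exists b, forall x, ~ S x -> x <= b.
Proof.
have [_ _ /finite_seqP[t Et]] := SN.
exists (\max_(i <- t) i) => x Sx.
have xt : x \in t by have : (~` S) x by []; rewrite Et.
by rewrite (big_rem _ xt) /= leq_maxl.
Qed.

Lemma gap_le_Frobenius x : ~ S x -> x <= F.
Proof.
have [b bP] := gaps_bounded.
by move=> Sx; apply: (max_natP (gaps S) b _ bP).2 => //; exists x.
Qed.

Lemma Frobenius_gap x : ~ S x -> ~ S F.
Proof.
have [b bP] := gaps_bounded.
by move=> Sx; apply: (max_natP (gaps S) b _ bP).1 => //; exists x.
Qed.

Lemma gt_Frobenius x : F < x -> S x.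
Proof.
by move=> Fx; apply: contrapT => /gap_le_Frobenius; rewrite leqNgt Fx.
Qed.

Lemma gap_lt_Frobenius x : ~ S x -> x <> F -> x < F.
Proof. by move=> /gap_le_Frobenius; lia. Qed.

Lemma gap_neq0 x : ~ S x -> x <> 0.
Proof. by have [S0 _ _] := SN; move=> Sx x0; apply: Sx; rewrite x0. Qed.

Lemma multiplicityP :
  [/\ S m, 0 < m & forall x, S x -> x <> 0 -> m <= x].
Proof.
have [|[Sm /= m0] mlb] := min_natP (S `\ 0).
  by exists F.+1; split=> //; apply: gt_Frobenius.
split=> //; first by move/eqP: m0; rewrite -lt0n.
by move=> x Sx x0; apply: mlb.
Qed.

Lemma Frobenius_special_gap x : ~ S x -> special_gaps S F.
Proof.
move=> /Frobenius_gap SF; have := gap_neq0 _ SF => F0.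
split=> // [|s [_ /= s0]]; apply: gt_Frobenius; lia.
Qed.

Lemma add_special_gap h :
  special_gaps S h -> numerical_semigroup (S `|` [set h]).
Proof.
have [S0 SD Sfin] := SN.
move=> [Sh S2h Shs]; split; first by left.
- have Sh' s : S s -> (S `|` [set h]) (h + s).
    by move=> Ss; case: (EM (s = 0)) => [->|s0];
      [rewrite addn0; right | left; apply: Shs].
  move=> a b [Sa|->] [Sb|->].
  + by left; apply: SD.
  + by rewrite addnC; apply: Sh'.
  + exact: Sh'.
  + by left; rewrite addnn -mul2n.
- by apply: sub_finite_set Sfin => x Ux Sx; apply: Ux; left.
Qed.

Lemma remove_minimal_generator y :
  minimal_generator S y -> numerical_semigroup (S `\ y).
Proof.
have [S0 SD Sfin] := SN.
move=> [[Sy /= y0] ymin]; split.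
- by split=> //= /esym.
- move=> a b [Sa /= ay] [Sb /= b_y]; split; first exact: SD.
  move=> /= E; apply: ymin; exists a, b; split=> //; split=> //= ab0.
    by apply: b_y; rewrite -E ab0.
  by apply: ay; rewrite -E ab0 addn0.
- have -> : ~` (S `\ y) = ~` S `|` [set y].
    apply/seteqP; split=> [x nSx|x [nSx [Sx _] //|-> [_]]] //=.
    by case: (EM (x = y)) => [->|xy]; [right | left => Sx; apply: nSx].
  by rewrite finite_setU.
Qed.

(* The largest [z] with [z] and [F - z] both gaps is a special gap: if [z + s]
   were a gap for a nonzero [s] of [S], then so would be [F - (z + s)], as
   [F - z = (F - (z + s)) + s]. *)
Lemma max_symmetric_gap x : ~ S x -> ~ S (F - x) -> 2 * x <> F ->
  exists z, [/\ special_gaps S z, z <> F, F < 2 * z &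
                forall y, ~ S y -> ~ S (F - y) -> y <= z].
Proof.
have [S0 SD _] := SN.
move=> Sx SFx x2.
pose X := [set y | ~ S y /\ ~ S (F - y)].
have XF y : X y -> y < F.
  move=> [Sy SFy]; rewrite ltnNge; apply/negP => Fy; apply: SFy.
  by have -> : F - y = 0 by lia.
have Xsym y : X y -> X (F - y).
  by move=> Xy; have yF := XF _ Xy; have [? ?] := Xy; split=> //; rewrite subKn // ltnW.
have [||Xz zub] := max_natP X F; first by exists x.
  by move=> y /XF/ltnW.
set z := max_nat X in Xz zub *.
have zF := XF _ Xz; have [Sz SFz] := Xz.
have Xx : X x by [].
have xF := XF _ Xx.
(* As [2 * x <> F], one of [x] and [F - x] exceeds half of [F], and [z] bounds both. *)
have z2 : F < 2 * z by have := zub _ Xx; have := zub _ (Xsym _ Xx); lia.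
exists z; split=> //; last by move=> y ? ?; apply: zub.
- split=> //; first exact: gt_Frobenius.
  move=> s [Ss /= s0]; apply: contrapT => Szs.
  have zsF := gap_le_Frobenius _ Szs.
  case: (EM (S (F - (z + s)))) => [Sd|nSd].
    apply: SFz; have -> : F - z = F - (z + s) + s by lia.
    exact: SD.
  have /zub : X (z + s) by [].
  by lia.
- by lia.
Qed.

(** Otherwise [S] would be the intersection of two strictly larger semigroups, obtained by adjoining
    [z] and [F] respectively. *)
Lemma irreducible_special_gap z :
  irreducible S -> special_gaps S z -> z = F.
Proof.
move=> irr sz; apply: contrapT => zF; have [Sz _ _] := sz.
have sF := Frobenius_special_gap _ Sz; have [SF _ _] := sF.
apply: irr; exists (S `|` [set z]), (S `|` [set F]); split.
- exact: add_special_gap.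
- exact: add_special_gap.
- by split=> [x|/(_ z)] //=; [left | move=> H; apply/Sz/H; right].
- by split=> [x|/(_ F)] //=; [left | move=> H; apply/SF/H; right].
- apply/seteqP; split=> [x Sx|x [[//|->] [//|/= E]]]; first by split; left.
  by case: zF.
Qed.

(* An oversemigroup strictly larger than [S] contains [F] as soon as every gap
   [a] satisfies [F - a \in S] or [2 a = F]. *)
Lemma not_irreducible_symmetric_gap :
  ~ irreducible S -> exists x, [/\ ~ S x, ~ S (F - x) & 2 * x <> F].
Proof.
move=> /contrapT[S1 [S2 [N1 N2 [SS1 S1S] [SS2 S2S] ES]]].
apply: contrapT => nX.
have FT T : numerical_semigroup T -> S `<=` T -> ~ T `<=` S -> T F.
  move=> [_ TD _] ST /existsNP[a /not_implyP[Ta Sa]].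
  have aF := gap_le_Frobenius _ Sa.
  case: (EM (S (F - a))) => [Sd|nSd].
    by rewrite -(subnKC aF); apply: TD => //; apply: ST.
  case: (EM (2 * a = F)) => [<-|aF2]; first by rewrite mul2n -addnn; apply: TD.
  by case: nX; exists a.
have [a /not_implyP[_ Sa]] : exists a, ~ (S1 a -> S a) by apply/existsNP.
by apply: (Frobenius_gap _ Sa); rewrite {1}ES; split; apply: FT.
Qed.

Lemma not_special_max_special_gap : ~ special S ->
  let h := max_nat (special_gaps S `\ F) in
  [/\ special_gaps S h, m < h, h < F &
      forall z, special_gaps S z -> z <> F -> z <= h].
Proof.
move=> /contrapT[k [[sk kF] mk]] h.
have [||[sh hF] hub] := max_natP (special_gaps S `\ F) F; first by exists k.
  by move=> y [[Sy _ _] _]; apply: gap_le_Frobenius.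
have [Sh _ _] := sh.
split=> //; last by move=> z *; apply: hub.
- by apply: leq_trans mk _; apply: hub.
- exact: gap_lt_Frobenius.
Qed.

(** As [a] and [r] lie below [F], the largest gap stays; the gaps trade [a] for [r] and the small
    elements trade [r] for [a]. *)
Lemma swap_invariants a r :
  ~ S a -> S r -> r <> 0 -> a < F -> r < F ->
  let T := (S `|` [set a]) `\ r in
  [/\ Frobenius T = F, genus T = genus S & num_small T = num_small S].
Proof.
move=> Sa Sr r0 aF rF T.
have SF := Frobenius_gap _ Sa.
have FT : Frobenius T = F.
  apply: max_natE.
    by move=> [[//|/= E] _]; move: aF; rewrite E ltnn.
  move=> y nTy; rewrite leqNgt; apply/negP => Fy; apply: nTy; split.
    by left; apply: gt_Frobenius.
  by move=> /= E; move: Fy; rewrite E ltnNge ltnW.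
have [_ _ Sfin] := SN.
split=> //.
- rewrite /genus -(card_nat_swap (gaps S) a r) //.
  congr card_nat; apply/seteqP; split=> x /=.
    move=> nTx; case: (EM (x = r)) => [->|xr]; [by right | left].
    by split=> [Sx|/= xa]; apply: nTx; split=> //; [left | right].
  by move=> [[Sx /= xa] [[] //]|-> [_ /=]]; apply.
- have fin : finite_set [set s | S s /\ s < F].
    apply: (@sub_finite_set _ _ `I_F); last exact: finite_II.
    by move=> x [].
  have small_a : ~ [set s | S s /\ s < F] a by case.
  have small_r : [set s | S s /\ s < F] r by [].
  rewrite /num_small FT -(card_nat_swap _ _ _ fin small_r small_a).
  congr card_nat; apply/seteqP; split=> x /=.
    by move=> [[[Sx|->] xr] xF]; [left | right].
  move=> [[[Sx xF] xr]|->]; first by split=> //; split=> //; left.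
  by split=> //; split; [right | move=> E; apply: Sa; rewrite E].
Qed.

End Semigroup.

(** * Almost ordinary semigroups *)

Lemma almost_ordinaryE g n : 2 <= n ->
  almost_ordinary g n = [set x | (x == 0) || (g <= x) && (x != (g + n).-1)].
Proof.
move=> n2; apply/seteqP; split=> x /=; first by move=> [->||]; lia.
case/orP => [/eqP ->|]; first by constructor 1.
by case: (leqP (g + n) x) => ?; [constructor 3 | constructor 2; lia].
Qed.

(** Two nonzero elements add up to at least [2 * g >= g + n], beyond the last gap [(g + n).-1]. *)
Lemma almost_ordinary_semigroup g n :
  2 <= n <= g -> numerical_semigroup (almost_ordinary g n).
Proof.
move=> /andP[n2 ng]; rewrite almost_ordinaryE //; split=> //.
  by move=> a b /=; lia.
apply: (@sub_finite_set _ _ `I_(g + n)); last exact: finite_II.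
by move=> x /=; lia.
Qed.

Section AlmostOrdinary.
Variables (g n : nat).
Hypotheses (g0 : 0 < g) (n2 : 2 <= n).
Local Notation O := (almost_ordinary g n).

Let OE := almost_ordinaryE g n n2.

Lemma Frobenius_almost_ordinary : Frobenius O = (g + n).-1.
Proof. by rewrite OE; apply: max_natE => [|y]; rewrite /gaps /setC /=; lia. Qed.

Lemma multiplicity_almost_ordinary : multiplicity O = g.
Proof. by rewrite OE; apply: min_natE => [|y [/=]]; [split=> /= |]; lia. Qed.

Lemma genus_almost_ordinary : genus O = g.
Proof.
rewrite /genus OE (card_natE _ ((g + n).-1 :: iota 1 g.-1)).
- by rewrite /= size_iota; lia.
- by rewrite /= iota_uniq mem_iota; lia.
- by move=> x; rewrite /gaps /setC /= inE mem_iota; lia.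
Qed.

Lemma num_small_almost_ordinary : num_small O = n.
Proof.
rewrite /num_small Frobenius_almost_ordinary OE (card_natE _ (0 :: iota g n.-1)).
- by rewrite /= size_iota; lia.
- by rewrite /= iota_uniq mem_iota; lia.
- by move=> x /=; rewrite inE mem_iota; lia.
Qed.

Lemma special_almost_ordinary : special O.
Proof.
move=> [h [[[+ _ _] /=]]].
rewrite multiplicity_almost_ordinary Frobenius_almost_ordinary OE /gaps /setC /=.
by lia.
Qed.

End AlmostOrdinary.

(** * The parent [calA S] of a non special semigroup *)

Section Parent.
Variable S : set nat.
Hypotheses (SN : numerical_semigroup S) (nsS : ~ special S).
Local Notation F := (Frobenius S).
Local Notation m := (multiplicity S).
Local Notation h := (max_nat (special_gaps S `\ Frobenius S)).
Local Notation T := (calA S).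

Let U := S `|` [set h].

Lemma calA_setU1 : T `|` [set m] = U.
Proof.
have [Sm m0 mlb] := multiplicityP _ SN.
apply/seteqP; split=> x; first by case=> [[Ux _]|->] //; left.
move=> Ux.
by case: (EM (x = m)) => [->|xm]; [right | left].
Qed.

(** Since [m < h], [m] is still the least nonzero element of [U], and a sum of two nonzero elements
    is at least [2 * m]. *)
Lemma minimal_generator_multiplicity : minimal_generator U m.
Proof.
have [Sm m0 mlb] := multiplicityP _ SN.
have [_ mh _ _] := not_special_max_special_gap _ SN nsS.
split; first by split; [left | move=> /=; lia].
have Um x : (U `\ 0) x -> m <= x by move=> [[Sx|->] /= x0]; [apply: mlb | lia].
by move=> [a [b [/Um ? /Um ? ?]]]; lia.
Qed.

Lemma calA_semigroup : numerical_semigroup T.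
Proof.
have [sh _ _ _] := not_special_max_special_gap _ SN nsS.
apply: remove_minimal_generator minimal_generator_multiplicity.
exact: add_special_gap.
Qed.

Lemma calA_invariants :
  [/\ Frobenius T = F, genus T = genus S & num_small T = num_small S].
Proof.
have [Sm m0 _] := multiplicityP _ SN.
have [[Sh _ _] mh hF _] := not_special_max_special_gap _ SN nsS.
by apply: swap_invariants => //; lia.
Qed.

Lemma lt_multiplicity_calA : m < multiplicity T.
Proof.
have [_ _ mlb] := multiplicityP _ SN.
have [_ mh _ _] := not_special_max_special_gap _ SN nsS.
have [[[Sx|->] /= xm] x0 _] := multiplicityP _ calA_semigroup; last by [].
by have := mlb _ Sx; lia.
Qed.

(** The sums to be tested stay in [U] by closure and exceed [m], the only element removed. *)
Lemma special_gap_calA_multiplicity : special_gaps T m.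
Proof.
have [Sm m0 _] := multiplicityP _ SN.
have [_ SD _] := SN.
have [sh _ _ _] := not_special_max_special_gap _ SN nsS.
have [_ UD _] := add_special_gap _ SN _ sh.
split; first by move=> [_ /=]; apply.
  by split; [left; rewrite mul2n -addnn; apply: SD | move=> /=; lia].
move=> s [[Us sm] /= s0]; split; last by move=> /=; lia.
by apply: UD => //; left.
Qed.

(* [m] and [F - m] are both gaps of [T], so by specialness the largest gap [z]
   with [F - z] also a gap lies below the multiplicity of [T]; a gap [y] of [T]
   above it would then give a nonzero [F - y < m] in [T]. *)
Lemma special_calA : special T ->
  T = almost_ordinary (multiplicity T) (F - multiplicity T).+1 /\
  multiplicity T < F.
Proof.
move=> spT.
have [_ SD _] := SN.
have [Sm m0 mlb] := multiplicityP _ SN.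
have [[Sh _ hs] mh hF _] := not_special_max_special_gap _ SN nsS.
have [FT _ _] := calA_invariants.
have mT := lt_multiplicity_calA.
have [TM M0 Mlb] := multiplicityP _ calA_semigroup.
have [Tm _ _] := special_gap_calA_multiplicity.
have SF := Frobenius_gap _ SN _ Sh.
have TF : ~ T F by rewrite -FT; apply: (Frobenius_gap _ calA_semigroup _ Tm).
(* If [F - m] were in [S], or equal to [h], then adding [m] would put [F] in [S]; in the second case
   because [h] is a special gap. *)
have TFm : ~ T (F - m).
  move=> [[Sd|/= Eh] _].
    by apply: SF; rewrite (_ : F = F - m + m); [apply: SD | lia].
  apply: SF; have -> : F = h + m by lia.
  by apply: hs; split=> //= ?; lia.
have m2 : 2 * m <> F by move=> E; apply: SF; rewrite -E mul2n -addnn; apply: SD.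
have := max_symmetric_gap _ calA_semigroup m Tm; rewrite FT.
move=> /(_ TFm m2)[z [sz zF _ zub]].
have zM : z <= multiplicity T.
  by rewrite leqNgt; apply/negP => Mz; apply: spT; exists z; rewrite FT.
have Fmz : F - m <= z by apply: zub => //; rewrite subKn //; lia.
have nogap y : multiplicity T < y -> y < F -> T y.
  move=> My yF; apply: contrapT => Ty.
  have : ~ T (F - y) by move=> /Mlb; lia.
  by move=> /(zub _ Ty); lia.
(* [h] remains in [T] because [h > m], so the multiplicity of [T] is at most [h < F]. *)
have MF : multiplicity T < F.
  have Th : T h by split; [right | move=> /=; lia].
  by have := Mlb _ Th; lia.
split=> //; rewrite almost_ordinaryE; last by lia.
apply/seteqP; split=> x /=.
  move=> Tx; case: (EM (x = 0)) => [->//|x0].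
  have : x <> F by move=> E; apply: TF; rewrite -E.
  by have := Mlb _ Tx x0; lia.
case/orP => [/eqP ->|/andP[Mx xF]]; first by have [] := calA_semigroup.
case: (ltngtP x F) => xF'; last by lia.
  by move: Mx; rewrite leq_eqVlt => /orP[/eqP <-//|Mx]; apply: nogap.
by apply: gt_Frobenius; [exact: calA_semigroup | rewrite FT].
Qed.

End Parent.

(** * Children: undoing [calA] *)

Lemma max_nat_lt (A : set nat) y :
  0 < y -> (forall z, A z -> z < y) -> max_nat A < y.
Proof. by move=> y0 Ay; rewrite /max_nat; case: xgetP => [z _ [/Ay]|]. Qed.

Lemma Frobenius_setU1 (S : set nat) a : numerical_semigroup S ->
  ~ S a -> a < Frobenius S -> Frobenius (S `|` [set a]) = Frobenius S.
Proof.
move=> SN Sa aF; have SF := Frobenius_gap _ SN _ Sa.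
apply: max_natE => [[//|/= E]|y nUy]; first by lia.
by apply: gap_le_Frobenius => // Sy; apply: nUy; left.
Qed.

Section Child.
Variables (T : set nat) (h y : nat).
Hypotheses (TN : numerical_semigroup T) (sTh : special_gaps T h).
Local Notation F := (Frobenius T).
Local Notation U := (T `|` [set h]).
Local Notation S := (U `\ y).

Lemma not_irreducible_large_special_gap : h < F -> ~ irreducible U ->
  exists z, [/\ special_gaps U z, z <> F & F < 2 * z].
Proof.
move=> hF; have UN := add_special_gap _ TN _ sTh; have [Th _ _] := sTh.
move/(not_irreducible_symmetric_gap _ UN) => [x [Ux UFx x2]].
have [z [sz zF z2 _]] := max_symmetric_gap _ UN x Ux UFx x2.
by exists z; rewrite Frobenius_setU1 // in zF z2.
Qed.

Hypotheses (hm : h < multiplicity T) (yU : minimal_generator U y).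
Hypotheses (yh : y <> h) (yF : y < F).

Let UN : numerical_semigroup U := add_special_gap _ TN _ sTh.

Lemma child_semigroup : numerical_semigroup S.
Proof. exact: remove_minimal_generator. Qed.

Let Ty : T y.
Proof. by have [[[//|]]] := yU. Qed.

Let hy : h < y.
Proof.
have [_ _ mlb] := multiplicityP _ TN; have [[_ /= y0] _] := yU.
by have := mlb _ Ty y0; lia.
Qed.

Lemma child_invariants :
  [/\ Frobenius S = F, genus S = genus T & num_small S = num_small T].
Proof. by have [Th _ _] := sTh; apply: swap_invariants => //; lia. Qed.

Lemma multiplicity_child : multiplicity S = h.
Proof.
have [Th _ _] := sTh; have h0 := gap_neq0 _ TN _ Th.
have [_ _ mlb] := multiplicityP _ TN.
apply: min_natE => [|x [[[Tx|->] //= _] x0]].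
  by split; [split; [right | move=> /=; lia] | exact: h0].
by have := mlb _ Tx x0; lia.
Qed.

Lemma special_gap_child : special_gaps S y.
Proof.
have [_ UD _] := UN; have Uy : U y by left.
split; first by move=> [_ /=]; apply.
  by split; [rewrite mul2n -addnn; apply: UD | move=> /=; lia].
move=> s [[Us _] /= s0]; split; first exact: UD.
by move=> /=; lia.
Qed.

Lemma not_special_child : ~ special S.
Proof.
move=> spS; apply: spS; exists y; rewrite multiplicity_child.
split=> //; split; first exact: special_gap_child.
by have [-> _ _] := child_invariants; move=> /=; lia.
Qed.

Hypothesis (yF2 : F < 2 * y).
Hypothesis (ymax : forall z, special_gaps U z -> z <> F -> z < y).

(** A special gap [z > y] of [S] would be one of [U], against [ymax]: the only new sum to test is
    [z + y], which exceeds [2 * y > F]. *)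
Lemma max_special_gap_child : max_nat (special_gaps S `\ Frobenius S) = y.
Proof.
have [-> _ _] := child_invariants.
apply: max_natE => [|z [[Sz S2z Szs] /= zF]].
  by split; [exact: special_gap_child | move=> /=; lia].
rewrite leqNgt; apply/negP => yz.
have Uz : ~ U z by move=> Uz; apply: Sz; split=> //= E; move: yz; rewrite E ltnn.
suff /ymax/(_ zF) : special_gaps U z by lia.
split=> //; first by have [] := S2z.
move=> s [Us /= s0]; case: (EM (s = y)) => [->|sy].
  by left; apply: gt_Frobenius => //; lia.
by have [] : S (z + s) by apply: Szs.
Qed.

Lemma calA_child : calA S = T.
Proof.
have [Th _ _] := sTh.
rewrite /calA max_special_gap_child multiplicity_child.
apply/seteqP; split=> x.
  by move=> [[[[//|/= ->] _]|-> //]] /=.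
move=> Tx; split; last by move=> /= E; apply: Th; rewrite -E.
by case: (EM (x = y)) => [->|xy]; [right | left; split=> //; left].
Qed.

End Child.

(** * Paths and edges of the graph *)

Section Graph.
Variables (g n : nat).
Hypothesis (hn : 2 <= n <= g).
Local Notation V := (vertices g n).
Local Notation E := (edges g n).
Local Notation O := (almost_ordinary g n).

Let n2 : 2 <= n. Proof. by case/andP: hn. Qed.
Let g0 : 0 < g. Proof. by lia. Qed.

Lemma vertexP T : V T -> [/\ numerical_semigroup T, genus T = g,
  num_small T = n & multiplicity T < Frobenius T].
Proof.
move=> [->|[TN nsT gT nT]]; split=> //.
- exact: almost_ordinary_semigroup.
- exact: genus_almost_ordinary.
- exact: num_small_almost_ordinary.
- by rewrite multiplicity_almost_ordinary // Frobenius_almost_ordinary //; lia.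
- by have [_ mh hF _] := not_special_max_special_gap _ TN nsT; lia.
Qed.

Lemma calA_vertex S : V S -> ~ special S -> V (calA S).
Proof.
move=> VS nsS; have [SN gS nS _] := vertexP _ VS.
have [FT gT nT] := calA_invariants _ SN nsS.
case: (EM (special (calA S))) => [spT|nspT]; last first.
  by right; split=> //; [exact: calA_semigroup | rewrite gT | rewrite nT].
left; have [ET MF] := special_calA _ SN nsS spT.
have [_ M0 _] := multiplicityP _ (calA_semigroup _ SN nsS).
(* Equating genus and number of small elements identifies the two parameters of the almost ordinary
   [calA S] with [g] and [n]. *)
set m := multiplicity (calA S) in ET MF M0.
move: gT nT; rewrite gS nS ET genus_almost_ordinary ?num_small_almost_ordinary //; try lia.
by move=> -> ->.
Qed.

Lemma special_vertex S : V S -> special S -> S = O.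
Proof. by move=> [->|[_ nsS _ _]]. Qed.

(** Each vertex has at most one outgoing edge, and none leaves [O], which is special; so two chains
    to [O] agree and stop together. *)
Lemma chain_unique x p q : chain E x O p -> chain E x O q -> p = q.
Proof.
have spO := special_almost_ordinary g n g0 n2.
elim: p q x => [|[a b] p IH] [|[c d] q] x //=.
- by move=> -> [[_ /= +] _ E1]; rewrite E1.
- by move=> [[_ /= +] _ E1 _] E2; rewrite E1 E2.
- move=> [[_ _ /= ->] -> cp] [[_ _ /= ->] -> cq].
  by congr (_ :: _); apply: IH cp cq.
Qed.

(** The multiplicity strictly increases along an edge, so the first edge cannot recur; the bound on
    the sources carries the induction. *)
Lemma chain_uniq x y p : chain E x y p ->
  uniq p /\ forall e, e \in p -> multiplicity x <= multiplicity e.1.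
Proof.
elim: p x => [//|[a b] p IH] x /= [[/= Va nsa ->] <- /IH[up mp]].
have [aN _ _ _] := vertexP _ Va.
have lt_m := lt_multiplicity_calA _ aN nsa.
split=> [|e].
  by rewrite up andbT; apply/negP => /mp /=; lia.
by rewrite inE => /orP[/eqP ->//|/mp]; apply/leq_trans/ltnW.
Qed.

Lemma chain_exists x : V x -> exists p, chain E x O p.
Proof.
(* Induction on a bound for this difference: [calA] lowers it, and it is positive at every
   vertex. *)
move: {2}(Frobenius x - multiplicity x) (leqnn (Frobenius x - multiplicity x)) => k.
elim: k x => [|k IH] x le_k Vx; have [xN _ _ mF] := vertexP _ Vx; first by lia.
case: (EM (special x)) => [spx|nsx]; first by exists [::]; apply: special_vertex.
have Vy := calA_vertex _ Vx nsx.
have lt_m := lt_multiplicity_calA _ xN nsx.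
have [FT _ _] := calA_invariants _ xN nsx.
have [|p cp] := IH _ _ Vy; first by rewrite FT; lia.
by exists ((x, calA x) :: p).
Qed.

Lemma edges_rooted_tree : rooted_tree V E O.
Proof.
split=> [[a b] [/= Va nsa ->]||x Vx _].
- by split=> //=; apply: calA_vertex.
- by left.
have [p cp] := chain_exists _ Vx.
exists p; split; first by split=> //; have [] := chain_uniq _ _ _ cp.
by move=> q [_ cq]; apply: chain_unique cp cq.
Qed.

Lemma edge_child S T : E (S, T) -> exists h y : nat,
  [/\ special_gaps T h, h < multiplicity T,
      minimal_generator (T `|` [set h]) y /\ y <> h,
      [/\ Frobenius T < 2 * y, y < Frobenius T &
        max_nat (special_gaps (T `|` [set h]) `\ Frobenius T) < y] &
      S = (T `|` [set h]) `\ y].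
Proof.
move=> [/= VS nsS ->]; have [SN _ _ _] := vertexP _ VS.
have [Sm m0 _] := multiplicityP _ SN.
have [_ SD _] := SN.
have [FT _ _] := calA_invariants _ SN nsS.
have [sy my yF ymax] := not_special_max_special_gap _ SN nsS.
have [Sy S2y Sys] := sy.
set y := max_nat _ in sy my yF ymax Sy S2y Sys.
exists (multiplicity S), y; rewrite FT calA_setU1 // -/y.
have gtS z : y < z -> (S `|` [set y]) z -> S z by move=> yz [//|/= E]; lia.
split.
- exact: special_gap_calA_multiplicity.
- exact: lt_multiplicity_calA.
- split; last by lia.
  split; first by split; [right | move=> /=; lia].
  (* Both summands of [y] are smaller than [y], hence in [S], which would force [y] into [S]. *)
  move=> [a [b [[Ua /= a0] [Ub /= b0] E]]]; apply: Sy; rewrite E.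
  by apply: SD; [case: Ua | case: Ub] => //= ?; lia.
- have SF := Frobenius_gap _ SN _ Sy.
  split=> //.
    (* Now [y] and [F - y] are both gaps, so there is a special gap [z <> F] with [F < 2 * z], and
       [z <= y] by maximality of [y]. *)
    have SFy : ~ S (Frobenius S - y).
      move=> Sd; apply: SF; rewrite -(subnKC (ltnW yF)); apply: Sys.
      by split=> //=; lia.
    have [|z [sz zF z2 _]] := max_symmetric_gap _ SN _ Sy SFy.
      by move=> E; apply: SF; rewrite -E.
    by have := ymax _ sz zF; lia.
  (* Positivity of [y] covers the default value 0 of an empty maximum. For [z > y], all sums tested
     exceed [y], so [z] would be a special gap of [S] above the maximal one. *)
  apply: max_nat_lt => [|z [[Uz U2z Uzs] /= zF]]; first by lia.
  rewrite ltnNge; apply/negP; rewrite leq_eqVlt => /orP[/eqP E|yz].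
    by apply: Uz; right.
  suff /ymax/(_ zF) : special_gaps S z by lia.
  split; first by move=> Sz; apply: Uz; left.
    by apply: gtS => //; lia.
  move=> s [Ss s0]; apply: gtS; first by lia.
  by apply: Uzs; split=> //; left.
- apply/seteqP; split=> x; last by move=> [[]].
  by move=> Sx; split; [left | move=> /= E; apply: Sy; rewrite -E].
Qed.

Lemma child_edge T h y : V T -> special_gaps T h -> h < multiplicity T ->
  minimal_generator (T `|` [set h]) y -> y <> h -> y < Frobenius T ->
  Frobenius T < 2 * y ->
  (forall z, special_gaps (T `|` [set h]) z -> z <> Frobenius T -> z < y) ->
  E ((T `|` [set h]) `\ y, T).
Proof.
move=> VT sTh hm yU yh yF yF2 ymax.
have [TN gT nT _] := vertexP _ VT.
have [_ gS nS] := child_invariants _ _ _ TN sTh hm yU yh yF.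
have nsS := not_special_child _ _ _ TN sTh hm yU yh yF.
split=> //=; last by rewrite calA_child.
by right; rewrite gS nS; split=> //; apply: child_semigroup.
Qed.

End Graph.

Theorem theorem5p6 (g n : nat) (hg : 3 < g) (hn : 2 <= n <= g - 2) :
  rooted_tree (vertices g n) (edges g n) (almost_ordinary g n) /\
  forall T : set nat, vertices g n T ->
    children g n T =
      [set S : set nat | exists h y : nat,
         [/\ special_gaps T h,
             h < multiplicity T,
             minimal_generator (T `|` [set h]) y /\ y <> h,
             (irreducible (T `|` [set h]) ->
                Frobenius T < 2 * y /\ y < Frobenius T) /\
             (~ irreducible (T `|` [set h]) ->
                max_nat (special_gaps (T `|` [set h]) `\ Frobenius T) < y
                /\ y < Frobenius T) &
             S = (T `|` [set h]) `\ y]].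
Proof.
have hn' : 2 <= n <= g by lia.
split; first exact: edges_rooted_tree.
move=> T VT; apply/seteqP; split=> S.
  move=> /(edge_child _ _ hn')[h [y [? ? ? [? ? ?] ?]]].
  by exists h, y; split.
move=> [h [y [sTh hm [yU yh] [irr nirr] ->]]].
have [TN _ _ mF] := vertexP _ _ hn' _ VT.
have UN := add_special_gap _ TN _ sTh; have [Th _ _] := sTh.
have hF : h < Frobenius T by lia.
have FU := Frobenius_setU1 _ _ TN Th hF.
case: (EM (irreducible (T `|` [set h]))) => [i|ni].
  have [yF2 yF] := irr i.
  (* An irreducible semigroup has no special gap besides its Frobenius number, so the bound on [z]
     holds vacuously. *)
  apply: child_edge => // z sz zF; case: zF; rewrite -FU.
  exact: irreducible_special_gap.
have [maxy yF] := nirr ni.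
(* This [z] makes the maximum a genuine one, and [z <= max < y] turns [F < 2 * z] into
   [F < 2 * y]. *)
have [z [sz zF z2]] := not_irreducible_large_special_gap _ _ TN sTh hF ni.
have [||_ ub] := max_natP (special_gaps (T `|` [set h]) `\ Frobenius T) (Frobenius T).
- by exists z.
- by move=> x [[Ux _ _] _]; rewrite -FU; apply: gap_le_Frobenius.
apply: child_edge => //; first by have := ub _ (conj sz zF); lia.
by move=> x sx xF; have := ub _ (conj sx xF); lia.
Qed.
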